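(* The polynomials $S_n(x,q)$ satisfy $$S_{n+1}(x,q)=(q+nx)S_n(x,q)+x(1-2x)\frac{\partial}{\partial x}S_n(x,q)\quad(n\ge0),$$ with $S_0(x,q)=1$. Furthermore, $$\sum_{n\ge0}S_n(x,q)\frac{z^n}{n!}=S(x,z)^q.$$
   Context: Permutations of $[n]=\{1,\dots,n\}$ are written in standard cycle decomposition (each cycle starts with its smallest element, cycles in increasing order of smallest elements). $\pi$ has an excedance at $i$ if $\pi(i)>i$; ${\rm exc}(\pi)$ is the number of excedances, ${\rm cyc}(\pi)$ the number of cycles. A value $x$ is a double excedance of $\pi$ if $\pi^{-1}(x)<x<\pi(x)$. A permutation $\pi$ of $[n]$ is a simsun permutation of the second kind if for every $k\in\{0,1,\dots,n\}$, deleting the $k$ largest letters from the cycle decomposition of $\pi$ yields a permutation with no double excedances; $\mathcal{SS}_n$ is the set of these, and $S_n(x,q)=\sum_{\pi\in\mathcal{SS}_n}x^{{\rm exc}(\pi)}q^{{\rm cyc}(\pi)}$. In one-line notation, ${\rm des}(\pi)=\#\{i\in[n-1]:\pi(i)>\pi(i+1)\}$, a double descent is an index $i$ with $\pi(i)>\pi(i+1)>\pi(i+2)$, and $\pi$ is (first-kind) simsun if for every $k\in[n]$ the subword of letters in $[k]$ has no double descents; with $\mathcal{RS}_n$ their set, $S_n(x)=\sum_{\pi\in\mathcal{RS}_n}x^{{\rm des}(\pi)}$, $S_0(x)=1$, and $S(x,z)=\sum_{n\ge0}S_n(x)\frac{z^n}{n!}$. *)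

(* Defs.v *)
From HB Require Import structures.
From mathcomp Require Import all_boot all_order all_algebra all_fingroup.
Set Implicit Arguments. Unset Strict Implicit. Unset Printing Implicit Defensive.
Import GRing.Theory.
Local Open Scope ring_scope.

(* Permutations of [n] are elements of 'S_n = {perm 'I_n}; the letter i+1 of
   the paper is the ordinal i (the order is preserved). *)

Definition T := {poly {poly rat}}.
Definition xvar : T := 'X.
Definition qvar : T := ('X : {poly rat})%:P.
Definition cst (r : rat) : T := (r%:P)%:P.

(* Deleting from the cycle decomposition of p all letters >= m (0-indexed,
   i.e. the n-m largest letters) yields the permutation sending a (< m) to the
   first iterate p^j(a), j >= 1, that is < m. *)
Definition restr n (p : 'S_n) (m : nat) (a : 'I_n) : 'I_n :=
  let s := [seq (p ^+ j)%g a | j <- iota 1 n] in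
  nth a s (find (fun y : 'I_n => (y < m)%N) s).

Definition no_dexc_restr n (p : 'S_n) (m : nat) : bool :=
  [forall a : 'I_n, (a < m)%N ==>
     ~~ ((a < restr p m a)%N && (restr p m a < restr p m (restr p m a))%N)].

Definition simsun2 n (p : 'S_n) : bool :=
  [forall m : 'I_n.+1, no_dexc_restr p m].

Definition exc n (p : 'S_n) : nat := #|[set i : 'I_n | (i < p i)%N]|.
Definition cyc n (p : 'S_n) : nat := #|porbits p|.

Definition Sxq (n : nat) : T :=
  \sum_(p : 'S_n | simsun2 p) xvar ^+ exc p * qvar ^+ cyc p.

Definition oneline n (p : 'S_n) : seq nat := [seq val (p i) | i <- enum 'I_n].

Definition no_ddes (s : seq nat) : bool :=
  all (fun i => ~~ ((nth 0 s i.+1 < nth 0 s i)%N && (nth 0 s i.+2 < nth 0 s i.+1)%N))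
      (iota 0 (size s - 2)).

Definition simsun1 n (p : 'S_n) : bool :=
  all (fun k => no_ddes [seq v <- oneline p | (v < k)%N]) (iota 1 n).

Definition des n (p : 'S_n) : nat :=
  count (fun i => (nth 0 (oneline p) i.+1 < nth 0 (oneline p) i)%N) (iota 0 (n - 1)).

Definition Sx (n : nat) : {poly rat} :=
  \sum_(p : 'S_n | simsun1 p) 'X ^+ des p.

Definition SxT (n : nat) : T := map_poly polyC (Sx n).

Definition trunc_egf (a : nat -> T) (N : nat) : {poly T} :=
  \poly_(n < N.+1) (cst (n`!%:R^-1) * a n).

Definition gbinom (k : nat) : T := cst (k`!%:R^-1) * \prod_(i < k) (qvar - i%:R).

(* For a series F with constant term 1, F^q := sum_k binom(q,k) (F-1)^k.
   Its coefficient of z^n only involves terms k <= n and coefficients of F of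
   order <= n, so it is computed on the truncation at order n.
   egf_qpow_coef a n = n! [z^n] (sum_n a_n z^n/n!)^q. *)
Definition egf_qpow_coef (a : nat -> T) (n : nat) : T :=
  n`!%:R * (\sum_(k < n.+1) (gbinom k)%:P * (trunc_egf a n - 1) ^+ k)`_n.

(* Main.v *)
Require Import Defs.
From HB Require Import structures.
From mathcomp Require Import all_boot all_order all_algebra all_fingroup.
From mathcomp Require Import ring zify.
Set Implicit Arguments. Unset Strict Implicit. Unset Printing Implicit Defensive.
Import GRing.Theory Num.Theory.
Local Open Scope ring_scope.

(** Inserting the largest letter into a simsun permutation, either into the
    cycles (second kind) or into the word (first kind), multiplies a monomial
    x^d by [(c + d) + (n - 2d) x]: [c] counts the insertions as a new cycle,
    respectively at the end of the word; the [d] insertions at an excedance,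
    respectively a descent, keep the statistic; [d] others create a forbidden
    pattern. This is the recurrence, with c = q, respectively c = 1.
    For the generating function F of the first kind, the recurrence reads
    L F = F where L is the derivation (1 - xz) d/dz - x(1 - 2x) d/dx. Hence
    L (F^q) = q F^q, which is the recurrence of the second kind, and the two
    sequences have the same initial value. *)

(** * Binomial powers of a formal power series *)

(** Congruence to 0 modulo z^N: polynomials in z stand for truncated power series. *)
Definition vanishes_below (R : nzRingType) (N : nat) (p : {poly R}) : Prop :=
  forall i, (i < N)%N -> p`_i = 0.

Section Vanishing.
Variable R : comNzRingType.
Implicit Types (p r : {poly R}) (N : nat).

Lemma vanishesD N p r :
  vanishes_below N p -> vanishes_below N r -> vanishes_below N (p + r).
Proof. by move=> hp hr i iN; rewrite coefD hp // hr // addr0. Qed.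

Lemma vanishesMl N p r : vanishes_below N r -> vanishes_below N (p * r).
Proof.
move=> hr i iN; rewrite coefM big1 // => j _.
by rewrite hr ?mulr0 // (leq_ltn_trans (leq_subr _ _)).
Qed.

Lemma vanishes_sum (I : finType) N (F : I -> {poly R}) :
  (forall i, vanishes_below N (F i)) -> vanishes_below N (\sum_i F i).
Proof. by move=> hF i iN; rewrite coef_sum big1 // => j _; apply: hF. Qed.

Lemma vanishes_exp p k : p`_0 = 0 -> vanishes_below k (p ^+ k).
Proof.
move=> p0; elim: k => [|k IH] // i ik; rewrite exprS coefM big1 // => j _.
have [->|j0] := posnP j; first by rewrite p0 mul0r.
rewrite IH ?mulr0 //; case: j j0 => -[|j] //= ji _.
by case: i ik ji => // i ik _; rewrite subSS (leq_ltn_trans (leq_subr _ _)).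
Qed.

Lemma vanishes_subX N p r k :
  vanishes_below N (p - r) -> vanishes_below N (p ^+ k - r ^+ k).
Proof. by move=> h; rewrite subrXX mulrC; apply: vanishesMl. Qed.
End Vanishing.

(* For the binomial coefficients b_k = binom(q,k): the defect in the implication
   [L F = F ==> L (F^q) = q F^q], with L a derivation and F = 1 + U, telescopes
   to a multiple of U^N. *)
Lemma binomial_telescope (R : comNzRingType) (b : nat -> R) (q U : R) (N : nat) :
  (forall k, b k.+1 * k.+1%:R = b k * (q - k%:R)) ->
  \sum_(k < N.+1) (b k * (U ^+ k.-1 *+ k) * (1 + U) - q * (b k * U ^+ k))
  = - (b N * (q - N%:R) * U ^+ N).
Proof.
move=> bS; elim: N => [|N IH].
  by rewrite big_ord_recl big_ord0 /=; ring.
by rewrite big_ord_recr /= IH -(bS N) -mulr_natr exprS; ring.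
Qed.

(** The right-hand side of the recurrence as an operator: [c = q] gives the second kind, [c = 1] the
    first. *)
Definition simsun_step (A : nzRingType) (c : {poly A}) (n : nat) (f : {poly A}) :
    {poly A} :=
  (c + n%:R * 'X) * f + 'X * (1 - 2%:R * 'X) * f^`().

(** * The derivation L and the power F^q *)

Section BinomialPower.
Variable A : comNzRingType.
Local Notation P := {poly A}.
Local Notation x := ('X : {poly A}).
Implicit Types (p r U : {poly P}).

Definition deriv_x p : {poly P} := map_poly (fun c : P => c^`()) p.

Lemma coef_deriv_x p i : (deriv_x p)`_i = (p`_i)^`().
Proof. by rewrite /deriv_x coef_map_id0 // deriv0. Qed.

Lemma deriv_xD p r : deriv_x (p + r) = deriv_x p + deriv_x r.
Proof. by apply/polyP => i; rewrite !(coefD, coef_deriv_x) derivD. Qed.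

Lemma deriv_xM p r : deriv_x (p * r) = deriv_x p * r + p * deriv_x r.
Proof.
apply/polyP => i; rewrite coefD !coef_deriv_x !coefM raddf_sum -big_split /=.
by apply: eq_bigr => j _; rewrite derivM !coef_deriv_x.
Qed.

Lemma deriv_x_const (c : A) : deriv_x (c%:P)%:P = 0.
Proof.
apply/polyP => i; rewrite coef_deriv_x coefC coef0.
by case: ifP => _; [exact: derivC | exact: deriv0].
Qed.

Lemma derivCM (c : A) (f : P) : (c%:P * f)^`() = c%:P * f^`().
Proof. by rewrite !mul_polyC derivZ. Qed.

(** The derivation L. The outer variable is z, so the plain derivative is d/dz, while [deriv_x] acts
    on the coefficients. *)
Definition pde_op p : {poly P} :=
  (1 - x%:P * 'X) * p^`() - (x * (1 - 2%:R * x))%:P * deriv_x p.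

(** For p_n = a_n / n! and c free of z, multiplying by n! turns L p = c p into the recurrence
    expressing a_(n+1) by [simsun_step c n]. *)
Lemma coef_pde_op p n :
  (pde_op p)`_n = p`_n.+1 *+ n.+1 - x * p`_n *+ n - x * (1 - 2%:R * x) * (p`_n)^`().
Proof.
rewrite /pde_op coefB coefCM coef_deriv_x mulrBl mul1r coefB coef_deriv.
rewrite -(mulrA x%:P) coefCM coefXM coef_deriv.
by case: n => [|n] /=; rewrite ?mulr0n ?mulr0 // mulrnAr.
Qed.

Lemma pde_opM p r : pde_op (p * r) = pde_op p * r + p * pde_op r.
Proof. by rewrite /pde_op derivM deriv_xM; move: (_%:P) => ?; ring. Qed.

Lemma pde_opD p r : pde_op (p + r) = pde_op p + pde_op r.
Proof. by rewrite /pde_op derivD deriv_xD; move: (_%:P) => ?; ring. Qed.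

Lemma pde_op_const (c : A) : pde_op (c%:P)%:P = 0.
Proof. by rewrite /pde_op derivC deriv_x_const !mulr0 subr0. Qed.

Lemma pde_op0 : pde_op 0 = 0.
Proof. by have := pde_op_const 0; rewrite !polyC0. Qed.

Lemma pde_op1 : pde_op 1 = 0.
Proof. by have := pde_op_const 1; rewrite !polyC1. Qed.

Lemma pde_opX p k : pde_op (p ^+ k) = p ^+ k.-1 * pde_op p *+ k.
Proof.
elim: k => [|k IH]; first by rewrite expr0 pde_op1 mulr0n.
rewrite exprS pde_opM IH mulrS /= mulrC; congr (_ + _).
by case: k {IH} => [|k]; rewrite ?mulr0n ?mulr0 // mulrnAr mulrA -exprS.
Qed.

Variables (q : A) (b invfact : nat -> A).
Hypothesis bS : forall k, b k.+1 * k.+1%:R = b k * (q - k%:R).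
Hypothesis invfact0 : invfact 0 = 1.
Hypothesis invfactS : forall k, invfact k.+1 * k.+1%:R = invfact k.

Definition qpow (N : nat) U : {poly P} := \sum_(k < N.+1) ((b k)%:P)%:P * U ^+ k.

(** With F = 1 + U, replacing L U by F in the termwise chain rule leaves a multiple of the error in
    L F = F, and the telescoping leaves a multiple of U^N. Both vanish below z^N, the latter because
    U has no constant term. *)
Lemma pde_op_qpow N U :
  U`_0 = 0 -> vanishes_below N (pde_op U - (1 + U)) ->
  vanishes_below N (pde_op (qpow N U) - (q%:P)%:P * qpow N U).
Proof.
move=> U0 hU.
have bPS k : ((b k.+1)%:P)%:P * k.+1%:R =
             ((b k)%:P)%:P * ((q%:P)%:P - k%:R) :> {poly P}.
  by rewrite -!polyC_natr -!polyCB -!polyCM bS.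
have -> : pde_op (qpow N U) - (q%:P)%:P * qpow N U =
    \sum_(k < N.+1) (((b k)%:P)%:P * (U ^+ k.-1 *+ k)) * (pde_op U - (1 + U))
    + (- (((b N)%:P)%:P * ((q%:P)%:P - N%:R))) * U ^+ N.
  rewrite mulNr -(binomial_telescope _ _ bPS) -big_split /= /qpow mulr_sumr.
  rewrite (big_morph _ pde_opD pde_op0) -sumrB.
  apply: eq_bigr => k _; rewrite pde_opM pde_op_const pde_opX.
  by move: ((b k)%:P)%:P (q%:P)%:P (pde_op U) => d c L; ring.
apply: vanishesD; last exact/vanishesMl/vanishes_exp.
by apply: vanishes_sum => k; apply: vanishesMl.
Qed.

Variable a : nat -> P.
Hypothesis a0 : a 0 = 1.

Definition trunc_series (N : nat) : {poly P} :=
  \poly_(n < N.+1) ((invfact n)%:P * a n).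

Definition qpow_coef n : P := n`!%:R * (qpow n (trunc_series n - 1))`_n.

Lemma trunc_series0 N : (trunc_series N - 1)`_0 = 0.
Proof. by rewrite coefB coef1 coef_poly /= a0 invfact0 mulr1 subrr. Qed.

(** Powers U^k with k > n start beyond z^n, and the truncations at n and N agree up to z^n. Thus the
    coefficients at n and n+1 can be read from one common series. *)
Lemma qpow_coefE n N : (n <= N)%N ->
  qpow_coef n = n`!%:R * (qpow N (trunc_series N - 1))`_n.
Proof.
move=> nN; congr (_ * _); rewrite /qpow !coef_sum.
rewrite (big_ord_widen_cond N.+1 predT (fun k =>
   (((b k)%:P)%:P * (trunc_series n - 1) ^+ k)`_n)) //= big_mkcond.
apply: eq_bigr => k _; rewrite !coefCM; case: ltnP => hk; last first.
  by rewrite (@vanishes_exp _ _ k) ?mulr0 // trunc_series0.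
congr (_ * _); apply/eqP; rewrite -subr_eq0 -coefB; apply/eqP.
apply: (@vanishes_subX _ n.+1) => // i iN.
by rewrite opprB addrA subrK coefB !coef_poly iN ltnS (leq_trans _ nN) ?subrr.
Qed.

Hypothesis aS : forall n, a n.+1 = simsun_step 1 n (a n).

Lemma qpow_coefS n : qpow_coef n.+1 = simsun_step q%:P n (qpow_coef n).
Proof.
rewrite (@qpow_coefE _ n.+1) // (@qpow_coefE n n.+1) //.
set U := trunc_series n.+1 - 1.
(* Coefficient i of dU/dz comes from z^(i+1), which the truncation at order n+1 keeps exactly for i
   <= n. *)
have hU : vanishes_below n.+1 (pde_op U - (1 + U)).
  move=> i iN; have -> : pde_op U = pde_op (1 + U) by rewrite (pde_opD 1) pde_op1 add0r.
  have -> : 1 + U = trunc_series n.+1 by rewrite /U addrC subrK.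
  rewrite coefB coef_pde_op !coef_poly ltnS iN ltnW ?ltnS // aS /simsun_step.
  rewrite derivCM -(invfactS i) polyCM polyC_natr.
  by move: (invfact i.+1)%:P (a i)^`() => d e; ring.
have := pde_op_qpow (trunc_series0 _) hU (ltnSn n).
move/eqP; rewrite coefB coefCM subr_eq0 coef_pde_op => /eqP.
rewrite /simsun_step; move: (qpow _ _)`_n.+1 (qpow _ _)`_n => u v h.
rewrite -(polyC_natr A n`!) derivCM polyC_natr.
suff -> : n.+1`!%:R * u = n`!%:R * (u *+ n.+1).
  by rewrite (canRL (subrK _) (canRL (subrK _) h)); ring.
by rewrite factS natrM -mulr_natr; ring.
Qed.
End BinomialPower.

(** binom(q,k) does not involve x: it is a constant over the ring of polynomials in q, hence killed
    by L. *)
Lemma gbinomE k :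
  gbinom k = ((k`!%:R^-1)%:P * \prod_(i < k) ('X - i%:R))%:P.
Proof.
rewrite /gbinom /cst polyCM rmorph_prod /=; congr (_ * _).
by apply: eq_bigr => i _; rewrite polyCB /qvar polyC_natr.
Qed.

Lemma invfactS k : (k.+1`!%:R^-1)%:P * k.+1%:R = (k`!%:R^-1)%:P :> {poly rat}.
Proof.
rewrite -polyC_natr -polyCM factS natrM invfM mulrAC mulVf ?mul1r //.
by rewrite pnatr_eq0.
Qed.

Lemma egf_qpow_coefS (a : nat -> T) : a 0 = 1 ->
  (forall n, a n.+1 = simsun_step 1 n (a n)) ->
  forall n, egf_qpow_coef a n.+1 = simsun_step qvar n (egf_qpow_coef a n).
Proof.
move=> a0 aS n.
pose invf k : {poly rat} := (k`!%:R^-1)%:P.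
pose b k : {poly rat} := invf k * \prod_(i < k) ('X - i%:R).
have qpowE m U : \sum_(k < m.+1) (gbinom k)%:P * U ^+ k = qpow b m U.
  by apply: eq_bigr => k _; rewrite gbinomE.
have E m : egf_qpow_coef a m = qpow_coef b invf a m.
  by rewrite /egf_qpow_coef qpowE.
rewrite !E; apply: qpow_coefS => // k.
- by rewrite /b big_ord_recr /= /invf -(invfactS k); ring.
- exact: invfactS.
Qed.

(** * Cycle insertion *)

Lemma leq_ord_max n (x : 'I_n.+1) : (x <= @ord_max n)%N.
Proof. exact: leq_ord. Qed.

(** An inductive form of [restr]: follow p from a up to the first letter below m. It allows
    induction along the path, where [restr] searches a list whose length depends on n. *)
Inductive first_return n (p : 'S_n) (m : nat) (a : 'I_n) : 'I_n -> Prop :=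
| FirstReturnNow : (p a < m)%N -> first_return p m a (p a)
| FirstReturnLater b : (m <= p a)%N -> first_return p m (p a) b ->
    first_return p m a b.

Lemma first_return_inj n (p : 'S_n) m a b c :
  first_return p m a b -> first_return p m a c -> b = c.
Proof.
move=> H; elim: H c => {a b} [a pam|a b pam _ IH] c H.
  by case: H pam => // d; rewrite leqNgt => /negbTE ->.
by case: H pam => [pam|d _ /IH //]; rewrite leqNgt pam.
Qed.

Lemma first_return_iter n (p : 'S_n) m k a :
  (iter k.+1 p a < m)%N -> (forall i, (i < k)%N -> (m <= iter i.+1 p a)%N) ->
  first_return p m a (iter k.+1 p a).
Proof.
elim: k a => [|k IH] a; first by move=> h _; apply: FirstReturnNow.
rewrite iterSr => h hi; apply: FirstReturnLater; first exact: (hi 0).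
by apply: IH => // i ik; rewrite -iterSr; apply: hi.
Qed.

Lemma first_return_restr n (p : 'S_n) m (a : 'I_n) :
  (a < m)%N -> first_return p m a (restr p m a).
Proof.
move=> am; rewrite /restr.
have -> : [seq (p ^+ j)%g a | j <- iota 1 n] = [seq iter j.+1 p a | j <- iota 0 n].
  by rewrite (iotaDl 1 0) -map_comp; apply: eq_map => j /=; rewrite permX.
set s := map _ _; set P := fun y : 'I_n => _.
have sz : size s = n by rewrite size_map size_iota.
have nths i : (i < n)%N -> nth a s i = iter i.+1 p a.
  by move=> ilt; rewrite (nth_map 0%N) ?size_iota // nth_iota.
(* The cycle of a has at most n elements and leads back to a < m, so the search succeeds and the
   default of [nth] is never returned. *)
have hs : has P s.
  have o_gt0 : (0 < #|porbit p a|)%N by apply/card_gt0P; exists a; apply: porbit_id.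
  apply/hasP; exists a => //; apply/mapP; exists #|porbit p a|.-1.
    by rewrite mem_iota add0n prednK //= (leq_trans (max_card _)) ?card_ord.
  by rewrite prednK // iter_porbit.
have kn : (find P s < n)%N by rewrite -[X in (_ < X)%N]sz -has_find.
rewrite nths //; apply: first_return_iter; first by rewrite -nths //;
  apply: (nth_find a hs).
move=> i ik; rewrite -nths ?(ltn_trans ik) // leqNgt.
by have := before_find a ik; rewrite /P => ->.
Qed.

Lemma restr_first_return n (p : 'S_n) m (a b : 'I_n) :
  (a < m)%N -> first_return p m a b -> restr p m a = b.
Proof. by move=> am; apply: first_return_inj (first_return_restr p am). Qed.

Lemma restr_lt n (p : 'S_n) m (a : 'I_n) : (a < m)%N -> (restr p m a < m)%N.
Proof. by move=> /(first_return_restr p); elim. Qed.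

Lemma no_dexc_restrP n (p : 'S_n) m :
  reflect (forall a : 'I_n, (a < m)%N -> (a < restr p m a)%N ->
             (restr p m (restr p m a) <= restr p m a)%N)
          (no_dexc_restr p m).
Proof.
apply: (iffP forallP) => h a; last first.
  by apply/implyP => am; apply/negP => /andP[/(h a am)]; rewrite leqNgt => /negbTE ->.
by move=> am ltr; move: (h a); rewrite am ltr /= -leqNgt.
Qed.

Lemma restr_full n (p : 'S_n) a : restr p n a = p a.
Proof. by apply: restr_first_return => //; apply: FirstReturnNow. Qed.

Section InsertCycle.
Variable n : nat.
Implicit Types (s : 'S_n) (i : 'I_n.+1).

(** Products of permutations act from left to right: i goes to the largest letter, which goes to the
    old image of i. For [i = ord_max] the largest letter forms a new cycle. *)
Definition insert_cycle s i : 'S_n.+1 :=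
  (tperm i ord_max * lift_perm ord_max ord_max s)%g.

Lemma insert_cycle_max s a :
  insert_cycle s ord_max (lift ord_max a) = lift ord_max (s a).
Proof. by rewrite permM tperm1 perm1 lift_perm_lift. Qed.

Lemma insert_cycle_max_max s : insert_cycle s ord_max ord_max = ord_max.
Proof. by rewrite permM tperm1 perm1 lift_perm_id. Qed.

Lemma insert_cycle_hit s i : insert_cycle s i i = ord_max.
Proof. by rewrite permM tpermL lift_perm_id. Qed.

Lemma insert_cycle_lift_max s k :
  insert_cycle s (lift ord_max k) ord_max = lift ord_max (s k).
Proof. by rewrite permM tpermR lift_perm_lift. Qed.

Lemma insert_cycle_other s i a :
  lift ord_max a != i ->
  insert_cycle s i (lift ord_max a) = lift ord_max (s a).
Proof.
by move=> ai; rewrite permM tpermD ?lift_perm_lift ?neq_lift // eq_sym.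
Qed.

(** The new path is the old one, possibly with a detour through [ord_max] after i; as m <= n, that
    letter is not below m and is passed over. *)
Lemma first_return_insert s i m a b : (m <= n)%N ->
  first_return s m a b ->
  first_return (insert_cycle s i) m (lift ord_max a) (lift ord_max b).
Proof.
move=> mn; elim=> {a b} [a sam|a b msa _ IH];
  (have [ai|ai] := eqVneq (lift ord_max a) i; last rewrite -?(insert_cycle_other s ai)).
- apply: FirstReturnLater; rewrite -ai insert_cycle_hit //.
  by rewrite -insert_cycle_lift_max; apply: FirstReturnNow;
    rewrite insert_cycle_lift_max lift_max.
- by apply: FirstReturnNow; rewrite insert_cycle_other // lift_max.
- apply: FirstReturnLater; rewrite -ai insert_cycle_hit //.
  by apply: FirstReturnLater; rewrite insert_cycle_lift_max ?ai // lift_max.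
- by apply: FirstReturnLater; rewrite insert_cycle_other // lift_max.
Qed.

Lemma restr_insert s i m (a : 'I_n) : (m <= n)%N -> (a < m)%N ->
  restr (insert_cycle s i) m (lift ord_max a) = lift ord_max (restr s m a).
Proof.
move=> mn am; apply: restr_first_return; first by rewrite lift_max.
exact/first_return_insert/first_return_restr.
Qed.

Lemma no_dexc_restr_insert s i m : (m <= n)%N ->
  no_dexc_restr (insert_cycle s i) m = no_dexc_restr s m.
Proof.
move=> mn; apply/no_dexc_restrP/no_dexc_restrP => h a am.
  have := h (lift ord_max a); rewrite !restr_insert ?restr_lt // !lift_max.
  exact.
have -> : a = lift ord_max (Ordinal (leq_trans am mn)).
  by apply: ord_inj; rewrite lift_max.
by rewrite !restr_insert ?restr_lt // !lift_max; apply: h.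
Qed.

(** Deleting the inserted letter gives back s, so the conditions for m <= n are those of s; only the
    undeleted permutation has to be tested. *)
Lemma simsun2_insert s i :
  simsun2 (insert_cycle s i) = simsun2 s && no_dexc_restr (insert_cycle s i) n.+1.
Proof.
apply/forallP/andP => [h|[/forallP h hn] m].
  split; last exact: (h ord_max).
  apply/forallP => m; rewrite -(no_dexc_restr_insert _ i) -1?ltnS //.
  by have := h (lift ord_max m); rewrite lift_max.
have [->|mm] := eqVneq m ord_max; first exact: hn.
have mn : (m < n.+1)%N by rewrite ltn_neqAle mm -ltnS ltn_ord.
by rewrite no_dexc_restr_insert //; apply: (h (Ordinal mn)).
Qed.
End InsertCycle.

Lemma no_dexc_fullP n (p : 'S_n) :
  reflect (forall a : 'I_n, (a < p a)%N -> (p (p a) <= p a)%N) (no_dexc_restr p n).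
Proof.
apply: (iffP (no_dexc_restrP p n)) => h a; last by rewrite !restr_full => _; apply: h.
by move: (h a); rewrite !restr_full; apply.
Qed.

Lemma simsun2_no_dexc n (p : 'S_n) (a : 'I_n) :
  simsun2 p -> (a < p a)%N -> (p (p a) <= p a)%N.
Proof. by move=> /forallP /(_ ord_max) /no_dexc_fullP; apply. Qed.

Lemma simsun2_insert_max n (s : 'S_n) : simsun2 (insert_cycle s ord_max) = simsun2 s.
Proof.
rewrite simsun2_insert andb_idr // => hs; apply/no_dexc_fullP => x.
have [a ->|->] := unliftP ord_max x; last by rewrite insert_cycle_max_max ltnn.
by rewrite !insert_cycle_max !lift_max; apply: simsun2_no_dexc.
Qed.

(** After the insertion k is mapped to the largest letter, so it is a double excedance exactly when
    its preimage under s is smaller. No other letter can become one. *)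
Lemma simsun2_insert_lift n (s : 'S_n) k :
  simsun2 (insert_cycle s (lift ord_max k)) = simsun2 s && (k <= (s^-1)%g k)%N.
Proof.
rewrite simsun2_insert; apply: andb_id2l => hs.
set p := insert_cycle _ _.
have pk : p (lift ord_max k) = ord_max by apply: insert_cycle_hit.
have pa a : a != k -> p (lift ord_max a) = lift ord_max (s a).
  by move=> ak; apply: insert_cycle_other; rewrite (inj_eq lift_inj).
apply/no_dexc_fullP/idP => [h|h x].
  rewrite leqNgt; apply/negP => bk.
  have := h (lift ord_max ((s^-1)%g k)).
  rewrite pa ?permKV ?pk; last by apply: contraTneq bk => ->; rewrite ltnn.
  by rewrite !lift_max bk leqNgt ltn_ord => /(_ isT).
have [a ->|->] := unliftP ord_max x; last by rewrite ltnNge leq_ord_max.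
have [->|ak] := eqVneq a k; first by rewrite pk leq_ord_max.
rewrite pa // !lift_max => lta; rewrite pa ?lift_max; last first.
  by apply: contraTneq lta => sak; move: h; rewrite -leqNgt -sak permK.
exact: simsun2_no_dexc.
Qed.

(** * Excedances and cycles under insertion *)

Lemma excE n (p : 'S_n) : exc p = (\sum_(i < n) (i < p i))%N.
Proof.
rewrite /exc -sum1_card big_mkcond; apply: eq_bigr => i _.
by rewrite inE; case: (i < p i)%N.
Qed.

Lemma exc_insert n (s : 'S_n) i :
  exc (insert_cycle s i) =
  (exc s + if unlift ord_max i is Some k then ~~ (k < s k)%N else false)%N.
Proof.
have excS (p : 'S_n.+1) : exc p =
    (\sum_(a < n) (lift ord_max a < p (lift ord_max a)))%N.
  by rewrite excE (bigD1_ord ord_max) // ltnNge leq_ord_max /= add0n.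
rewrite excS excE; clear excS.
have [k ->|->] := unliftP ord_max i; last first.
  by rewrite addn0; apply: eq_bigr => a _; rewrite insert_cycle_max !lift_max.
rewrite (bigD1 k) // [in RHS](bigD1 k) // insert_cycle_hit.
rewrite lift_max ltn_ord addnAC; congr (_ + _)%N; first by case: (k < s k)%N.
apply: eq_bigr => a ak.
by rewrite insert_cycle_other ?(inj_eq lift_inj) // !lift_max.
Qed.

Lemma porbit_lift n (s : 'S_n) a :
  porbit (lift_perm ord_max ord_max s) (lift ord_max a) = lift ord_max @: porbit s a.
Proof.
have it j : ((lift_perm ord_max ord_max s) ^+ j)%g (lift ord_max a) =
            lift ord_max ((s ^+ j)%g a).
  by rewrite !permX; elim: j => //= j ->; rewrite lift_perm_lift.
apply/setP => x; apply/porbitP/imsetP => [[j ->]|[b /porbitP[j ->] ->]].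
  by exists ((s ^+ j)%g a) => //; apply: mem_porbit.
by exists j.
Qed.

Lemma porbit_lift_max n (s : 'S_n) :
  porbit (lift_perm ord_max ord_max s) ord_max = [set ord_max].
Proof.
apply/setP => x; rewrite inE; apply/porbitP/eqP => [[j ->]|->];
  last by exists 0; rewrite perm1.
by rewrite permX; elim: j => //= j ->; rewrite lift_perm_id.
Qed.

Lemma cyc_lift n (s : 'S_n) : cyc (lift_perm ord_max ord_max s) = (cyc s).+1.
Proof.
rewrite /cyc /porbits.
have -> : [set porbit (lift_perm ord_max ord_max s) x | x in 'I_n.+1] =
   [set ord_max] |: [set lift ord_max @: B | B : {set 'I_n} in porbits s].
  apply/setP => B; rewrite in_setU1.
  apply/imsetP/predU1P => [[x _ ->]|[->|/imsetP[C /imsetP[a _ ->] ->]]].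
  - have [a ->|->] := unliftP ord_max x; last by left; apply: porbit_lift_max.
    by right; rewrite porbit_lift; apply: imset_f; apply: imset_f.
  - by exists ord_max; rewrite ?porbit_lift_max.
  - by exists (lift ord_max a); rewrite ?porbit_lift.
rewrite cardsU1 card_imset; last exact/imset_inj/lift_inj.
rewrite (_ : _ \notin _) //; apply/negP => /imsetP[C _ /setP/(_ ord_max)].
by rewrite inE eqxx => /esym/imsetP[a _ /eqP]; rewrite eq_liftF.
Qed.

(** Multiplying by the transposition merges the cycle of i with the singleton of [ord_max], which
    undoes the extra cycle of [cyc_lift] unless [i = ord_max]. *)
Lemma cyc_insert n (s : 'S_n) i : cyc (insert_cycle s i) = (cyc s + (i == ord_max))%N.
Proof.
have := porbits_mul_tperm (lift_perm ord_max ord_max s) i ord_max.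
rewrite porbit_lift_max inE /= -!/(cyc _) cyc_lift -/(insert_cycle s i).
by case: eqVneq => _ /=; rewrite ?addn0 ?addn1 ?addn2 // => -[].
Qed.

(* E marks the d positions keeping the statistic, D the d positions creating a
   forbidden pattern; elsewhere the statistic grows. *)
Lemma insertion_count (R : comNzRingType) n (E D : pred 'I_n) (y : R) (d : nat) :
  (forall i, ~~ (E i && D i)) ->
  (\sum_(i < n) E i)%N = d -> (\sum_(i < n) D i)%N = d ->
  \sum_(i < n) (if E i then y ^+ d else if D i then 0 else y ^+ d.+1)
  = d%:R * y ^+ d + (n%:R - 2%:R * d%:R) * y ^+ d.+1.
Proof.
move=> ED sE sD.
have -> : \sum_(i < n) (if E i then y ^+ d else if D i then 0 else y ^+ d.+1) =
   \sum_(i < n) ((E i)%:R * y ^+ d + (1 - (E i)%:R - (D i)%:R) * y ^+ d.+1).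
  apply: eq_bigr => i _; have := ED i.
  by case: (E i); case: (D i) => //= _; ring.
rewrite big_split /= -!mulr_suml !sumrB -!natr_sum sE sD sumr_const card_ord.
by ring.
Qed.

Lemma simsun_step_Xn (A : comNzRingType) (c : {poly A}) n d :
  simsun_step c n 'X^d =
  c * 'X^d + (d%:R * 'X^d + (n%:R - 2%:R * d%:R) * 'X^(d.+1)).
Proof.
rewrite /simsun_step derivXn -mulr_natr.
by case: d => [|d] /=; rewrite ?mulr0n !exprS; ring.
Qed.

Lemma simsun_step_monomial (A : comNzRingType) (q : A) n d k :
  simsun_step q%:P n ('X^d * q%:P ^+ k) =
  'X^d * q%:P ^+ k.+1 +
  (d%:R * 'X^d + (n%:R - 2%:R * d%:R) * 'X^(d.+1)) * q%:P ^+ k.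
Proof.
transitivity (simsun_step q%:P n 'X^d * q%:P ^+ k).
  rewrite /simsun_step -polyC_exp [_ * (q ^+ k)%:P]mulrC derivCM.
  by move: (q ^+ k)%:P ('X^d)^`() => w f; ring.
by rewrite simsun_step_Xn (exprS _ k); ring.
Qed.

Lemma simsun_step_sum (A : comNzRingType) (c : {poly A}) n (I : finType) (Q : pred I)
    (F : I -> {poly A}) :
  simsun_step c n (\sum_(i | Q i) F i) = \sum_(i | Q i) simsun_step c n (F i).
Proof. by rewrite /simsun_step raddf_sum /= !mulr_sumr -big_split. Qed.

(** * Decomposing permutations of n+1 letters by the place of insertion *)

Lemma insert_cycle_inj n : injective (fun u : 'S_n * 'I_n.+1 => insert_cycle u.1 u.2).
Proof.
move=> [s i] [t j] /= h.
(* The place of insertion is the preimage of the largest letter. *)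
have ij : i = j.
  apply: (@perm_inj _ (insert_cycle s i)).
  by rewrite {2}h !insert_cycle_hit.
move: h; rewrite {i}ij => /mulgI h; congr (_, _); apply/permP => a.
by apply: (@lift_inj _ ord_max); rewrite -!(lift_perm_lift ord_max) h.
Qed.

Lemma lift_perm_pair_inj n :
  injective (fun u : 'S_n * 'I_n.+1 => lift_perm u.2 ord_max u.1).
Proof.
move=> [s i] [t j] /= h.
have ij : i = j.
  apply: (@perm_inj _ (lift_perm i ord_max s)).
  by rewrite {2}h !lift_perm_id.
move: h; rewrite {i}ij => h; congr (_, _); apply/permP => a.
by apply: (@lift_inj _ ord_max); rewrite -!(lift_perm_lift j) h.
Qed.

(** An injection is onto here, since both sides have (n+1)! elements. *)
Lemma sum_permS (V : nmodType) n (f : 'S_n * 'I_n.+1 -> 'S_n.+1) (F : 'S_n.+1 -> V) :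
  injective f -> \sum_p F p = \sum_(s : 'S_n) \sum_(i < n.+1) F (f (s, i)).
Proof.
move=> fI; rewrite pair_big /= (reindex f) /=; first by apply: eq_bigr => -[].
apply: onW_bij; apply: inj_card_bij => //.
by rewrite card_prod !card_Sn card_ord factS mulnC.
Qed.

Lemma perm0E (p : 'S_0) : p = 1%g.
Proof. by apply/permP; case. Qed.

Lemma Sxq0 : Sxq 0 = 1.
Proof.
rewrite /Sxq (big_pred1 1%g) => [|p]; last first.
  by rewrite /= (perm0E p) eqxx; apply/forallP => m; apply/forallP; case.
have -> : exc (1%g : 'S_0) = 0%N by apply: eq_card0; case.
have -> : cyc (1%g : 'S_0) = 0%N.
  by apply: eq_card0 => B; apply/negP => /imsetP[[]].
by rewrite !expr0 mulr1.
Qed.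

Lemma SxqS n : Sxq n.+1 = simsun_step qvar n (Sxq n).
Proof.
rewrite /Sxq simsun_step_sum big_mkcond (sum_permS _ (@insert_cycle_inj n)) /=.
rewrite [RHS]big_mkcond; apply: eq_bigr => s _.
(* The place [ord_max] opens a new cycle and gives the term q. *)
rewrite (bigD1_ord ord_max) //= simsun2_insert_max exc_insert unlift_none addn0.
rewrite cyc_insert eqxx addn1.
under eq_bigr => k _ do
  rewrite simsun2_insert_lift exc_insert liftK cyc_insert lift_eqF addn0.
case: ifP => hs /=; last by rewrite big1 // addr0.
rewrite simsun_step_monomial; congr (_ + _).
(* Inserting after k keeps the statistic if k is an excedance, and is forbidden if the preimage of k
   is smaller than k; both at once would make k a double excedance of s. *)
rewrite -(@insertion_count _ n (fun k => (k < s k)%N) (fun k => ((s^-1)%g k < k)%N)).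
- rewrite mulr_suml; apply: eq_bigr => k _; rewrite [in LHS]leqNgt.
  have [lt1|le1] := ltnP k (s k).
    rewrite ifT ?addn0 // -leqNgt.
    rewrite leqNgt; apply/negP => lt2; have := simsun2_no_dexc hs (a := (s^-1)%g k).
    by rewrite !permKV lt2 leqNgt lt1 => /(_ isT).
  by rewrite addn1; case: ltnP; rewrite ?mul0r.
- move=> k; apply/negP => /andP[lt1 lt2].
  have := simsun2_no_dexc hs (a := (s^-1)%g k).
  by rewrite !permKV lt2 leqNgt lt1 => /(_ isT).
- by rewrite excE.
(* Writing k = s(j) turns the forbidden places k into the excedances j. *)
- rewrite excE (reindex_inj (@perm_inj _ s)) /=.
  by apply: eq_bigr => k _; rewrite permK.
Qed.

(** * Word insertion *)

(** The size test excludes the last index, where the default 0 of [nth] could look like a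
    descent. *)
Definition descent_at (w : seq nat) (i : nat) : bool :=
  (i.+1 < size w)%N && (nth 0 w i.+1 < nth 0 w i)%N.

Definition insert_letter (w : seq nat) (i M : nat) : seq nat :=
  take i w ++ M :: drop i w.

Lemma no_ddesP (w : seq nat) :
  reflect (forall i, ~~ (descent_at w i && descent_at w i.+1)) (no_ddes w).
Proof.
apply: (iffP allP) => h i; rewrite /descent_at.
  case: (ltnP i.+2 (size w)) => hi; last by rewrite /= !andbF.
  have /h : i \in iota 0 (size w - 2) by rewrite mem_iota add0n ltn_subRL add2n.
  by rewrite (ltnW hi).
rewrite mem_iota add0n ltn_subRL add2n => /= hi.
by have := h i; rewrite /descent_at hi (ltnW hi).
Qed.

Section InsertLetter.
Variables (w : seq nat) (i M : nat).
Hypothesis iw : (i <= size w)%N.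
Hypothesis wM : forall j, (j < size w)%N -> (nth 0 w j < M)%N.
Let w' := insert_letter w i M.

Lemma size_insert_letter : size w' = (size w).+1.
Proof. by rewrite size_cat /= size_takel // size_drop addnS subnKC. Qed.

Lemma nth_insert_letter j :
  nth 0 w' j = if (j < i)%N then nth 0 w j else if j == i then M else nth 0 w j.-1.
Proof.
rewrite nth_cat size_takel //; case: ltngtP => [ji|ij|->].
- by rewrite nth_take.
- by rewrite -(subnSK ij) /= nth_drop; congr nth; lia.
- by rewrite subnn.
Qed.

(** The step into M is an ascent, the step out of M a descent unless M stands last; the other cases
    are descents of w, with indices shifted past i. *)
Lemma descent_at_insert j :
  descent_at w' j =
  if (j.+1 < i)%N then descent_at w j else
  if j.+1 == i then false else
  if j == i then (i < size w)%N else descent_at w j.-1.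
Proof.
rewrite /descent_at size_insert_letter !nth_insert_letter ltnS.
case: (ltngtP j.+1 i) => [ji|ij|ji].
- by rewrite (leq_trans ji iw) (leq_trans (ltnW ji) iw).
- case: (eqVneq j i) => [->|ne] /=; last by case: j ij ne => [|j] //=; lia.
  by rewrite andb_idr //; apply: wM.
- have h : (nth 0 w j < M)%N by apply: wM; rewrite ji.
  by rewrite [(M < _)%N]ltnNge (ltnW h) andbF.
Qed.

Lemma descent_at_insert_ge j : (i < j)%N -> descent_at w' j = descent_at w j.-1.
Proof.
move=> ij; rewrite descent_at_insert.
have -> : (j.+1 < i)%N = false by lia.
have -> : (j.+1 == i) = false by lia.
by rewrite gtn_eqF.
Qed.

Lemma descent_at_insert_eq : descent_at w' i = (i < size w)%N.
Proof.
rewrite descent_at_insert eqxx.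
have -> : (i.+1 < i)%N = false by lia.
by have -> : (i.+1 == i) = false by lia.
Qed.

(** M is entered by an ascent, so a new double descent can only start at M and continue with a
    descent of w at i. *)
Lemma no_ddes_insert : no_ddes w -> no_ddes w' = ~~ descent_at w i.
Proof.
move=> /no_ddesP hw; apply/no_ddesP/idP => [h|h j].
  apply: contra (h i) => hi.
  rewrite descent_at_insert_eq descent_at_insert_ge //= hi andbT.
  by case/andP: hi => /ltnW.
case: (ltngtP j i) => [ji|ij|->].
- rewrite descent_at_insert; case: (ltnP j.+1 i) => h1.
    rewrite (descent_at_insert j.+1); case: (ltngtP j.+2 i) => h2.
    + exact: hw.
    + by move: h1; rewrite ltnNge -ltnS h2.
    + by rewrite andbF.
  by have -> : (j.+1 == i) = true by lia.
- rewrite !descent_at_insert_ge ?(ltnW ij) //; last exact: ltnW.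
  by case: j ij => // j _; apply: hw.
- by rewrite (@descent_at_insert_ge i.+1) // (negbTE h) andbF.
Qed.
End InsertLetter.

Lemma size_oneline n (p : 'S_n) : size (oneline p) = n.
Proof. by rewrite size_map size_enum_ord. Qed.

Lemma nth_oneline n (p : 'S_n) (j : 'I_n) : nth 0 (oneline p) j = p j :> nat.
Proof. by rewrite (nth_map j) ?size_enum_ord // nth_ord_enum. Qed.

Lemma nth_oneline_lt n (p : 'S_n) j :
  (j < size (oneline p))%N -> (nth 0 (oneline p) j < n)%N.
Proof.
by rewrite size_oneline => jn; rewrite -[j]/(nat_of_ord (Ordinal jn)) nth_oneline.
Qed.

Lemma leq_size_oneline n (s : 'S_n) (i : 'I_n.+1) : (i <= size (oneline s))%N.
Proof. by rewrite size_oneline leq_ord. Qed.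

Lemma oneline_lift n (s : 'S_n) (i : 'I_n.+1) :
  oneline (lift_perm i ord_max s) = insert_letter (oneline s) i n.
Proof.
have iw := leq_size_oneline s i.
apply: (@eq_from_nth _ 0%N) => [|j].
  by rewrite size_insert_letter // !size_oneline.
rewrite size_oneline => jn; rewrite nth_insert_letter //.
rewrite -[j]/(nat_of_ord (Ordinal jn)) nth_oneline.
have [k ->|->] := unliftP i (Ordinal jn); last by rewrite lift_perm_id ltnn eqxx.
rewrite lift_perm_lift lift_max -nth_oneline /= /bump.
by case: (leqP i k) => ik; rewrite ?add1n ?add0n ?ik //= ltnNge ltnW // gtn_eqF.
Qed.

(** The subword of letters below k <= n misses the inserted letter n, so only k = n+1, the whole
    word, is new. *)
Lemma simsun1_lift n (s : 'S_n) i :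
  simsun1 (lift_perm i ord_max s) =
  simsun1 s && no_ddes (oneline (lift_perm i ord_max s)).
Proof.
have iotaS : iota 1 n.+1 = iota 1 n ++ [:: n.+1].
  by rewrite -[in LHS](addn1 n) iotaD add1n.
rewrite /simsun1 iotaS all_cat /= andbT; congr (_ && _).
  apply: eq_in_all => k; rewrite mem_iota add1n ltnS => /andP[_ kn].
  by rewrite oneline_lift filter_cat /= ltnNge kn /= -filter_cat cat_take_drop.
congr no_ddes; apply/all_filterP/(all_nthP 0%N) => j; exact: nth_oneline_lt.
Qed.

Lemma simsun1_no_ddes n (s : 'S_n) : simsun1 s -> no_ddes (oneline s).
Proof.
case: n s => [|n] s /allP h; first by rewrite /no_ddes size_oneline.
have := h n.+1; rewrite mem_iota /= add1n ltnSn => /(_ isT).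
rewrite (_ : filter _ _ = oneline s) //.
by apply/all_filterP/(all_nthP 0%N) => j; exact: nth_oneline_lt.
Qed.

Lemma descent_at_last n (s : 'S_n) j :
  (n <= j.+1)%N -> descent_at (oneline s) j = false.
Proof. by move=> nj; rewrite /descent_at size_oneline ltnNge nj. Qed.

Lemma desE n (s : 'S_n) : des s = (\sum_(j < n) descent_at (oneline s) j)%N.
Proof.
case: n s => [|n] s; first by rewrite big_ord0.
rewrite big_ord_recr /= descent_at_last // addn0 /des subn1 -sum1_count.
rewrite -(big_mkord predT (fun j => nat_of_bool (descent_at (oneline s) j))).
rewrite /index_iota subn0 big_mkcond; apply: eq_big_seq => j.
rewrite mem_iota /descent_at size_oneline => /andP[_]; rewrite ltnS => -> /=.
by case: ifP.
Qed.

(** For D the descents of a word: a letter inserted at i splits the descent from i-1 to i. *)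
Definition preceded (D : pred nat) (i : nat) : bool := (0 < i)%N && D i.-1.

Lemma sum_preceded n (D : pred nat) : (forall j, (n <= j.+1)%N -> D j = false) ->
  (\sum_(j < n) preceded D j)%N = (\sum_(j < n) D j)%N.
Proof.
case: n => [|n] hD; first by rewrite !big_ord0.
by rewrite big_ord_recl big_ord_recr /= hD // addn0.
Qed.

(** The largest letter creates a descent after itself unless it stands last, and destroys the
    descent that it splits. Adding on both sides avoids truncated subtraction. *)
Lemma des_lift n (s : 'S_n) (i : 'I_n.+1) :
  (des (lift_perm i ord_max s) + preceded (descent_at (oneline s)) i =
   des s + (i < n))%N.
Proof.
set D := descent_at _.
(* [lift i k] is the new index of the letter at k; its descent survives unless the inserted letter
   directly follows it. *)
have hl : {in predT, forall k : 'I_n,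
    descent_at (oneline (lift_perm i ord_max s)) (lift i k)
    = D k && (k.+1 != i)}.
  move=> k _; rewrite oneline_lift.
  rewrite (descent_at_insert (leq_size_oneline s i)) //=; last first.
    exact: nth_oneline_lt.
  rewrite /bump; case: (leqP i k) => ik; rewrite ?add1n ?add0n.
    have -> : (k.+2 < i)%N = false by lia.
    have -> : (k.+2 == i) = false by lia.
    have -> : (k.+1 == i) = false by lia.
    by rewrite andbT.
  case: ltngtP => h; rewrite ?andbT ?andbF //; lia.
rewrite !desE (bigD1_ord i) //=.
rewrite [in X in (X + _ + _)%N]oneline_lift.
rewrite (descent_at_insert_eq (leq_size_oneline s i)); last exact: nth_oneline_lt.
rewrite size_oneline addnC addnCA addnC; congr (_ + _)%N.
under eq_bigr => k _ do rewrite hl //.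
rewrite [RHS](eq_bigr (fun k : 'I_n =>
  (D k && (k.+1 != i)) + (D k && (k.+1 == i)))%N); last first.
  by move=> k _; rewrite -/D; case: (D k) => //=; case: eqP.
rewrite big_split [RHS]addnC /=; congr (_ + _)%N; rewrite /preceded.
case: i {hl} => -[|i] hi /=; first by rewrite big1 // => k _; rewrite andbF.
rewrite (bigD1 (@Ordinal n i hi)) //= eqxx andbT big1 ?addn0 // => k.
by rewrite -val_eqE eqSS => /negbTE /= ->; rewrite andbF.
Qed.

Lemma Sx0 : Sx 0 = 1.
Proof.
rewrite /Sx (big_pred1 1%g) => [|p]; last by rewrite /= (perm0E p) eqxx.
by rewrite desE big_ord0.
Qed.

Lemma SxS n : Sx n.+1 = simsun_step 1 n (Sx n).
Proof.
rewrite /Sx simsun_step_sum big_mkcond (sum_permS _ (@lift_perm_pair_inj n)) /=.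
rewrite [RHS]big_mkcond; apply: eq_bigr => s _.
under eq_bigr => i _ do rewrite simsun1_lift.
case: ifP => hs /=; last by rewrite big1.
have hd := simsun1_no_ddes hs; set D := descent_at (oneline s).
have ddes_lift (i : 'I_n.+1) : no_ddes (oneline (lift_perm i ord_max s)) = ~~ D i.
  rewrite oneline_lift (no_ddes_insert (leq_size_oneline s i)) //.
  exact: nth_oneline_lt.
(* Insertion at the end keeps [des] and accounts for c = 1. *)
rewrite (bigD1_ord ord_max) //= ddes_lift /D descent_at_last //=.
have des_max := des_lift s ord_max.
have -> : des (lift_perm ord_max ord_max s) = des s.
  move: des_max; rewrite ltnn addn0 => <-.
  by rewrite /preceded descent_at_last ?andbF ?addn0 //=; case: (n).
rewrite simsun_step_Xn mul1r; congr (_ + _).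
(* Splitting a descent keeps the number of descents; inserting just before the top of a descent
   creates a double descent. No place does both, as s has no double descent. *)
rewrite -(@insertion_count _ n (fun k => preceded D k) (fun k => D k)).
- apply: eq_bigr => k _; have := des_lift s (lift ord_max k).
  rewrite ddes_lift lift_max ltn_ord addn1 -/D.
  case pk: (preceded D k); rewrite ?addn1 ?addn0.
    move=> [->]; case: ifP => //; move: pk; rewrite /preceded.
    case: (nat_of_ord k) => // j /= Dj /negbFE Dj1.
    by have /no_ddesP/(_ j) := hd; rewrite -/D Dj Dj1.
  by move=> ->; rewrite if_neg.
- move=> k; apply/negP; rewrite /preceded.
  case: (nat_of_ord k) => // j /= /andP[Dj Dj1].
  by have /no_ddesP/(_ j) := hd; rewrite -/D Dj Dj1.
- by rewrite sum_preceded ?desE // => j; apply: descent_at_last.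
- by rewrite desE.
Qed.

Lemma SxTS n : SxT n.+1 = simsun_step 1 n (SxT n).
Proof.
rewrite /SxT SxS /simsun_step !(rmorphD, rmorphN, rmorphM, rmorph1, rmorph_nat) /=.
by rewrite map_polyX deriv_map.
Qed.

Theorem theorem13 :
  Sxq 0 = 1 /\
  (forall n : nat,
     Sxq n.+1 = (qvar + n%:R * xvar) * Sxq n
                + xvar * (1 - 2%:R * xvar) * (Sxq n)^`()) /\
  (forall n : nat, egf_qpow_coef SxT n = Sxq n).
Proof.
split; first exact: Sxq0.
split=> [n|]; first exact: SxqS.
have SxT0 : SxT 0 = 1 by rewrite /SxT Sx0 rmorph1.
(* Both sequences satisfy the recurrence with c = q, so only n = 0 remains, where the sum is
   binom(q,0) = 1. *)
elim=> [|n IH]; last by rewrite (egf_qpow_coefS SxT0 SxTS) IH SxqS.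
rewrite Sxq0 /egf_qpow_coef big_ord_recl big_ord0 addr0 expr0 mulr1 coefC /=.
by rewrite /gbinom big_ord0 mulr1 fact0 invr1 mul1r.
Qed.
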